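(* Let $f:\mathbb{R}^n\to\mathbb{R}$ be differentiable (not necessarily convex) and bounded below by some $f^*\in\mathbb{R}$. Let $\mathcal{B}$ be the set of available blocks, and for each $b\in\mathcal{B}$ let $H_b\in\mathbb{R}^{|b|\times|b|}$ be a symmetric positive-definite matrix. Assume that $\nabla f$ is Lipschitz continuous with respect to the matrices $H_b$, i.e. for every $b\in\mathcal{B}$, $x\in\mathbb{R}^n$ and $d\in\mathbb{R}^{|b|}$, $$\|\nabla_b f(x+U_b d)-\nabla_b f(x)\|_{H_b^{-1}}\le \|d\|_{H_b}.$$ Then the block coordinate descent method using either the GSQ, GSL, GSD or GS selection rule (the last three corresponding to the specific choices of $H_b$ described in the context) satisfies, for all $k\ge 1$, $$\min_{t=0,1,\dots,k-1}\|\nabla f(x^t)\|_{\mathcal{B}}^2\le\frac{2\,(f(x^0)-f^* )}{k},$$ where $\|v\|_{\mathcal{B}}=\max_{b\in\mathcal{B}}\|v_b\|_{H_b^{-1}}$.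
   Context: Blocks: $\mathcal{B}$ is a finite collection of nonempty subsets of $\{1,\dots,n\}$ whose union is $\{1,\dots,n\}$ (for example a fixed partition, or all subsets of a given size). For $b\in\mathcal{B}$, $U_b\in\{0,1\}^{n\times|b|}$ consists of the columns of the identity matrix indexed by $b$; $v_b=U_b^Tv$, and $\nabla_b f(x)=U_b^T\nabla f(x)$. For positive-definite $H$, $\|v\|_H=\sqrt{v^THv}$. Block coordinate descent (BCD) method: from $x^0\in\mathbb{R}^n$, at iteration $k$ a block $b_k\in\mathcal{B}$ is chosen and $$x^{k+1}=x^k-U_{b_k}H_{b_k}^{-1}\nabla_{b_k}f(x^k).$$ Selection rules (ties broken arbitrarily): - GSQ (block Gauss-Southwell-Quadratic): $b_k\in\arg\max_{b\in\mathcal{B}}\|\nabla_b f(x^k)\|_{H_b^{-1}}$, for general positive-definite $H_b$. - GSD (block Gauss-Southwell-Diagonal): the GSQ rule with $H_b=D_b$ diagonal with positive diagonal entries, so $b_k\in\arg\max_{b}\sum_{i\in b}|\nabla_i f(x^k)|^2/D_{b,i}$. - GSL (block Gauss-Southwell-Lipschitz): the GSQ rule with $H_b=L_bI$ for constants $L_b>0$, so $b_k\in\arg\max_b \|\nabla_b f(x^k)\|^2/L_b$. - GS (block Gauss-Southwell): the GSQ rule with $H_b=LI$ for a constant $L>0$ common to all blocks, so $b_k\in\arg\max_b\|\nabla_b f(x^k)\|$. In each case the same matrices $H_b$ are used in the Lipschitz assumption, the norm $\|\cdot\|_{\mathcal{B}}$, the selection rule and the update. *)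

(* Defs.v *)
From mathcomp Require Import all_boot all_order all_algebra.
From mathcomp Require Import all_classical all_reals all_analysis.
Set Implicit Arguments.
Unset Strict Implicit.
Unset Printing Implicit Defensive.
Import Order.TTheory GRing.Theory Num.Theory.
Import numFieldNormedType.Exports.
Local Open Scope ring_scope.

Section Norms.
Variable R : realType.

Definition posdef m (A : 'M[R]_m) : Prop :=
  A^T = A /\ forall v : 'cV[R]_m, v != 0 -> 0 < (v^T *m A *m v) 0 0.

(* A norm when A is positive definite. *)
Definition mxnorm m (A : 'M[R]_m) (v : 'cV[R]_m) : R :=
  Num.sqrt ((v^T *m A *m v) 0 0).

(* The library norm `|v| on matrices is the sup norm, hence this definition. *)
Definition enorm m (v : 'cV[R]_m) : R := Num.sqrt (\sum_i v i 0 ^+ 2).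

(* The vector of partial derivatives; it represents 'd f x as soon as f is
   differentiable at x. *)
Definition grad n (f : 'cV[R]_n -> R) (x : 'cV[R]_n) : 'cV[R]_n :=
  \col_i ('D_(delta_mx i 0) f x).

End Norms.

Section Blocks.
Variables (R : realType) (n : nat).
Implicit Types (B : {set {set 'I_n}}) (b : {set 'I_n}).

Definition block_family B : Prop :=
  finset.set0 \notin B /\ finset.cover B = [set: 'I_n]%SET.

(* The columns of the identity matrix indexed by b, in increasing order. *)
Definition Ublk b : 'M[R]_(n, #|b|) :=
  colsub (fun j : 'I_#|b| => enum_val j) 1%:M.

Definition blk b (v : 'cV[R]_n) : 'cV[R]_#|b| := (Ublk b)^T *m v.

(* Only the values of H on B are constrained; outside B they are junk. *)
Definition blk_lipschitz B (H : forall b, 'M[R]_#|b|) (f : 'cV[R]_n -> R) :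
    Prop :=
  forall b, b \in B -> forall (x : 'cV[R]_n) (d : 'cV[R]_#|b|),
    mxnorm (invmx (H b)) (blk b (grad f (x + Ublk b *m d)) - blk b (grad f x))
      <= mxnorm (H b) d.

(* The seed 0 is harmless, as mxnorm is nonnegative. *)
Definition blknorm B (H : forall b, 'M[R]_#|b|) (v : 'cV[R]_n) : R :=
  \big[Num.max/0]_(b in B) mxnorm (invmx (H b)) (blk b v).

(* A relation rather than a choice function, so that ties may be broken
   arbitrarily. *)
Definition is_argmax B (F : {set 'I_n} -> R) b : Prop :=
  b \in B /\ forall b', b' \in B -> F b' <= F b.

(* In the rules below, g is the gradient at the current iterate. *)
Definition GSQ B (H : forall b, 'M[R]_#|b|) (g : 'cV[R]_n) b : Prop :=
  is_argmax B (fun b' => mxnorm (invmx (H b')) (blk b' g)) b.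

(* D b i is used for i \in b only. *)
Definition GSD B (D : {set 'I_n} -> 'I_n -> R) (g : 'cV[R]_n) b : Prop :=
  is_argmax B (fun b' => \sum_(i in b') `|g i 0| ^+ 2 / D b' i) b.

Definition GSL B (L : {set 'I_n} -> R) (g : 'cV[R]_n) b : Prop :=
  is_argmax B (fun b' => enorm (blk b' g) ^+ 2 / L b') b.

Definition GS B (g : 'cV[R]_n) b : Prop :=
  is_argmax B (fun b' => enorm (blk b' g)) b.

Definition diag_blk (D : {set 'I_n} -> 'I_n -> R) b : 'M[R]_#|b| :=
  diag_mx (\row_(j < #|b|) D b (enum_val j)).

Definition bcd_step (H : forall b, 'M[R]_#|b|) (f : 'cV[R]_n -> R) b
    (x : 'cV[R]_n) : 'cV[R]_n :=
  x - Ublk b *m (invmx (H b) *m blk b (grad f x)).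

End Blocks.

(* Main.v *)
(* Integrating the Lipschitz bound along the segment from x to its successor
   gives f (x^{k+1}) <= f (x^k) - |grad_b f (x^k)|_{H_b^-1}^2 / 2, and each of
   the four rules selects a block whose dual norm is |grad f (x^k)|_B.
   Telescoping bounds the sum of |grad f (x^t)|_B^2 over t < k, hence k times
   its minimum, by 2 (f (x^0) - fstar). *)
Require Import Defs.
From mathcomp Require Import all_boot all_order all_algebra.
From mathcomp Require Import all_classical all_reals all_analysis.
From mathcomp Require Import ring lra.
Import Order.TTheory GRing.Theory Num.Theory.
Import numFieldNormedType.Exports.
Local Open Scope ring_scope.

Lemma posdef_unitmx (R : realType) m (A : 'M[R]_m) : posdef A -> A \in unitmx.
Proof.
move=> [_ Apos]; rewrite unitmxE unitfE; apply/negP => /det0P[v v0 vA].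
have := Apos v^T; rewrite trmxK vA mul0mx mxE ltxx => vF.
by have /vF : v^T != 0 by rewrite trmx_eq0.
Qed.

Lemma posdef_form_ge0 (R : realType) m (A : 'M[R]_m) (v : 'cV[R]_m) :
  posdef A -> 0 <= (v^T *m A *m v) 0 0.
Proof.
move=> [_ Apos]; have [->|/Apos/ltW//] := eqVneq v 0.
by rewrite mulmx0 mxE.
Qed.

Lemma sqr_mxnorm (R : realType) m (A : 'M[R]_m) (v : 'cV[R]_m) :
  posdef A -> mxnorm A v ^+ 2 = (v^T *m A *m v) 0 0.
Proof. by move=> A_pd; rewrite sqr_sqrtr // posdef_form_ge0. Qed.

Lemma mxnormZ (R : realType) m (A : 'M[R]_m) (t : R) (v : 'cV[R]_m) :
  mxnorm A (t *: v) = `|t| * mxnorm A v.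
Proof.
rewrite /mxnorm [(t *: v)^T]linearZ /= -!scalemxAl -scalemxAr scalerA mxE.
by rewrite -expr2 sqrtrM ?sqr_ge0 // sqrtr_sqr.
Qed.

(** Moves the dual norm back to the norm of [A] itself, so that later arguments use positive
    definiteness of [A] alone. *)
Lemma mxnorm_invmx (R : realType) m (A : 'M[R]_m) (v : 'cV[R]_m) :
  posdef A -> mxnorm (invmx A) v = mxnorm A (invmx A *m v).
Proof.
move=> A_pd; have uA := posdef_unitmx _ _ _ A_pd.
by rewrite /mxnorm trmx_mul trmx_inv A_pd.1 -!mulmxA mulKVmx.
Qed.

(* Expand the form at [invmx A *m c - t *: d]. *)
Lemma posdef_dot_le {R : realType} {m} {A : 'M[R]_m} {c d : 'cV[R]_m} {t : R} :
  posdef A -> 0 < t -> mxnorm (invmx A) c <= t * mxnorm A d ->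
  (c^T *m d) 0 0 <= t * mxnorm A d ^+ 2.
Proof.
move=> A_pd t0; have uA := posdef_unitmx _ _ _ A_pd.
rewrite mxnorm_invmx //; set e := invmx A *m c => ed.
have -> : c = A *m e by rewrite /e mulKVmx.
clearbody e.
have ed2 : mxnorm A e ^+ 2 <= t ^+ 2 * mxnorm A d ^+ 2.
  by rewrite -exprMn lerXn2r // nnegrE ?mulr_ge0 ?sqrtr_ge0 // ltW.
have := posdef_form_ge0 _ _ _ (e - t *: d) A_pd.
have -> : ((e - t *: d)^T *m A *m (e - t *: d)) 0 0 =
    mxnorm A e ^+ 2 - 2 * t * ((A *m e)^T *m d) 0 0 + t ^+ 2 * mxnorm A d ^+ 2.
  have dAe : (d^T *m A *m e) 0 0 = (e^T *m A *m d) 0 0.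
    (* A 1 by 1 matrix equals its transpose, and [A] is symmetric, so the two cross terms agree. *)
    have -> : e^T *m A *m d = (d^T *m A *m e)^T.
      by rewrite !trmx_mul trmxK A_pd.1 mulmxA.
    by rewrite [RHS]mxE.
  rewrite !sqr_mxnorm // trmx_mul A_pd.1 [(_ - _)^T]linearB /=.
  rewrite [(t *: d)^T]linearZ /= !(mulmxBl, mulmxBr) -!scalemxAl -!scalemxAr.
  have addE (X Y : 'M[R]_1) : (X + Y) 0 0 = X 0 0 + Y 0 0 by rewrite mxE.
  have oppE (X : 'M[R]_1) : (- X) 0 0 = - X 0 0 by rewrite mxE.
  have scaleE a (X : 'M[R]_1) : (a *: X) 0 0 = a * X 0 0 by rewrite mxE.
  by rewrite !(addE, oppE, scaleE) dAe; ring.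
(* Nonnegativity of the form and [ed2] bound the cross term by twice [t ^+ 2 * mxnorm A d ^+ 2];
   then [2 * t] cancels. *)
move=> q_ge0; have : 2 * t * ((A *m e)^T *m d) 0 0 <=
    2 * t * (t * mxnorm A d ^+ 2) by lra.
by rewrite ler_pM2l // mulr_gt0.
Qed.

(** The differential is linear, so it suffices to expand [v] in the standard basis. *)
Lemma derive_grad (R : realType) n (f : 'cV[R]_n -> R) (x v : 'cV[R]_n) :
  differentiable f x -> 'D_v f x = ((grad f x)^T *m v) 0 0.
Proof.
move=> df; rewrite deriveE // [v in LHS]matrix_sum_delta linear_sum mxE /=.
apply: eq_bigr => i _; rewrite big_ord1 linearZ /= !mxE deriveE //.
by rewrite mulrC.
Qed.

Lemma is_derive_line (R : realType) n (f : 'cV[R]_n -> R) (x u : 'cV[R]_n)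
    (t : R) : differentiable f (x + t *: u) ->
  is_derive t 1 (fun s : R => f (x + s *: u))
    (((grad f (x + t *: u))^T *m u) 0 0).
Proof.
move=> df; rewrite -derive_grad //.
have /derivableP[fd fE] : derivable f (x + t *: u) u by exact: diff_derivable.
(* Both difference quotients are the same function of [h], so existence and value of the limit carry
   over. *)
have quotE : (fun h : R => h^-1 *: (((fun s : R => f (x + s *: u))
      \o shift t) (h *: 1) - f (x + t *: u))) =
    (fun h : R => h^-1 *: ((f \o shift (x + t *: u)) (h *: u)
      - f (x + t *: u))).
  apply/funext => h /=; congr (_ *: (f _ - _)).
  by rewrite [h *: 1]mulr1 scalerDl addrCA.
by split; [rewrite /derivable quotE | rewrite /derive quotE].
Qed.

(** The mean value theorem does the work of the integral: [p], the function along the segment minus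
    the non-constant part of its quadratic bound, has nonpositive derivative on the open unit
    interval, hence [p 1 <= p 0]. *)
Lemma descent (R : realType) n (f : 'cV[R]_n -> R) (x u : 'cV[R]_n) (C : R) :
  (forall y, differentiable f y) ->
  (forall t : R, 0 < t ->
    ((grad f (x + t *: u) - grad f x)^T *m u) 0 0 <= t * C) ->
  f (x + u) <= f x + ((grad f x)^T *m u) 0 0 + C / 2.
Proof.
move=> df gradC; set a : R := ((grad f x)^T *m u) 0 0.
pose p (t : R) := f (x + t *: u) - (a * t + C / 2 * t ^+ 2).
pose dp (t : R) := ((grad f (x + t *: u))^T *m u) 0 0 - (a + C * t).
have pd (t : R) : is_derive t 1 p (dp t).
  have := is_derive_line _ _ _ _ _ _ (df (x + t *: u)).
  move=> lined; apply: is_derive_eq.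
  by rewrite /dp; congr (_ - _); rewrite /GRing.scale /=; field.
have pc : {within `[0, 1], continuous p}%classic.
  apply: continuous_subspaceT => t; apply: differentiable_continuous.
  by apply/derivable1_diffP; case: (pd t).
have [c c01 pE] := MVT ltr01 (fun t _ => pd t) pc.
have : dp c <= 0.
  have := gradC c; rewrite (itvP c01) => /(_ isT).
  rewrite [(_ - _)^T]linearB /= mulmxBl mxE [X in _ + X]mxE -/a /dp; lra.
move: pE; rewrite /p scale1r scale0r addr0; lra.
Qed.

(** Along the step [s], the linear term is minus the squared dual norm of [g], and the quadratic
    term restores half of it. *)
Lemma block_descent (R : realType) n (f : 'cV[R]_n -> R) (B : {set {set 'I_n}})
    (H : forall c : {set 'I_n}, 'M[R]_#|c|) (c : {set 'I_n}) (x : 'cV[R]_n) :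
  (forall y, differentiable f y) -> blk_lipschitz B H f -> c \in B ->
  posdef (H c) ->
  f (bcd_step H f c x) <=
    f x - mxnorm (invmx (H c)) (blk c (grad f x)) ^+ 2 / 2.
Proof.
move=> df fLip cB Hpd; have uH := posdef_unitmx _ _ _ Hpd.
set g := blk c (grad f x); set s := - (invmx (H c) *m g).
have dotU y : (y^T *m (Ublk R c *m s)) = (blk c y)^T *m s.
  by rewrite /blk trmx_mul trmxK mulmxA.
have sN : mxnorm (H c) s = mxnorm (invmx (H c)) g.
  by rewrite mxnorm_invmx // /s -scaleN1r mxnormZ normrN1 mul1r.
have -> : bcd_step H f c x = x + Ublk R c *m s by rewrite /s mulmxN.
have := descent _ _ f x (Ublk R c *m s) (mxnorm (H c) s ^+ 2) df.
rewrite !dotU -/g sN => /(_ _) /le_trans; apply.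
  (* The Lipschitz assumption at displacement [t *: s] bounds the dual norm of the gradient change;
     [posdef_dot_le] turns this into a bound on its product with [s]. *)
  move=> t t0; rewrite dotU -sN; apply: (posdef_dot_le Hpd t0).
  rewrite -[t in leRHS]gtr0_norm // -mxnormZ scalemxAr.
  by have := fLip c cB x (t *: s); rewrite /blk -mulmxBr.
have -> : (g^T *m s) 0 0 = - mxnorm (invmx (H c)) g ^+ 2.
  rewrite mxnorm_invmx // sqr_mxnorm // /s mulmxN mxE; congr (- _ _ _).
  by rewrite [(invmx _ *m _)^T]trmx_mul trmx_inv Hpd.1 -!mulmxA mulKVmx.
lra.
Qed.

Lemma blknorm_argmax {R : realType} {n} {B : {set {set 'I_n}}}
    {H : forall c : {set 'I_n}, 'M[R]_#|c|} {v : 'cV[R]_n} {c : {set 'I_n}} :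
  GSQ B H v c -> blknorm B H v = mxnorm (invmx (H c)) (blk c v).
Proof.
move=> [cB cmax]; apply/le_anti/andP; split.
  by apply: bigmax_le => //; exact: sqrtr_ge0.
exact: (le_bigmax_cond _ (fun c => mxnorm (invmx (H c)) (blk c v))).
Qed.

Lemma blkE (R : realType) n (c : {set 'I_n}) (v : 'cV[R]_n) (j : 'I_#|c|) :
  blk c v j 0 = v (enum_val j) 0.
Proof. by rewrite /blk /Ublk trmx_mxsub trmx1 mul_rowsub_mx mul1mx mxE. Qed.

(** The right side is the square root of the score in [GSD]; as the square root is monotone, a
    maximiser for [GSD] is one for [GSQ]. *)
Lemma mxnorm_diag (R : realType) n (D : {set 'I_n} -> 'I_n -> R)
    (c : {set 'I_n}) (v : 'cV[R]_n) : (forall i, i \in c -> 0 < D c i) ->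
  mxnorm (invmx (diag_blk D c)) (blk c v) =
  Num.sqrt (\sum_(i in c) `|v i 0| ^+ 2 / D c i).
Proof.
move=> D0.
pose E := diag_mx (\row_(j < #|c|) (D c (enum_val j))^-1).
have DE : diag_blk D c *m E = 1%:M.
  rewrite /E /diag_blk mulmx_diag; apply/matrixP => i j; rewrite !mxE.
  by rewrite divff // gt_eqF // D0 // enum_valP.
have [uD _] := mulmx1_unit DE.
have -> : invmx (diag_blk D c) = E by rewrite -[LHS]mulmx1 -DE mulKmx.
rewrite /mxnorm big_enum_val mxE; congr Num.sqrt; apply: eq_bigr => j _.
by rewrite mul_mx_diag blkE mxE [_^T _ _]mxE blkE mxE real_normK ?num_real // expr2 mulrAC.
Qed.

Lemma mxnorm_scalar (R : realType) m (L : R) (v : 'cV[R]_m) :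
  mxnorm (invmx L%:M) v = Num.sqrt (enorm v ^+ 2 / L).
Proof.
rewrite /mxnorm invmx_scalar mul_mx_scalar -scalemxAl mxE mulrC mxE.
rewrite sqr_sqrtr ?sumr_ge0 // => [|i _]; last exact: sqr_ge0.
by congr (Num.sqrt (_ / _)); apply: eq_bigr => i _; rewrite mxE expr2.
Qed.

Lemma GSD_GSQ (R : realType) n (B : {set {set 'I_n}})
    (H : forall c : {set 'I_n}, 'M[R]_#|c|) (D : {set 'I_n} -> 'I_n -> R)
    (v : 'cV[R]_n) (c : {set 'I_n}) :
  (forall (a : {set 'I_n}) i, a \in B -> i \in a -> 0 < D a i) ->
  (forall a : {set 'I_n}, a \in B -> H a = diag_blk D a) ->
  GSD B D v c -> GSQ B H v c.
Proof.
move=> D0 HD [cB cmax]; split=> // a aB; rewrite !HD // !mxnorm_diag.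
- by rewrite ler_wsqrtr // cmax.
- by move=> i; exact: D0.
- by move=> i; exact: D0.
Qed.

Lemma GSL_GSQ (R : realType) n (B : {set {set 'I_n}})
    (H : forall c : {set 'I_n}, 'M[R]_#|c|) (L : {set 'I_n} -> R)
    (v : 'cV[R]_n) (c : {set 'I_n}) :
  (forall a : {set 'I_n}, a \in B -> H a = (L a)%:M) ->
  GSL B L v c -> GSQ B H v c.
Proof.
move=> HL [cB cmax]; split=> // a aB.
by rewrite !HL // !mxnorm_scalar ler_wsqrtr // cmax.
Qed.

(** Squaring nonnegative numbers and dividing by a common positive constant both preserve order. *)
Lemma GS_GSL (R : realType) n (B : {set {set 'I_n}}) (L : R) (v : 'cV[R]_n)
    (c : {set 'I_n}) : 0 < L -> GS B v c -> GSL B (fun=> L) v c.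
Proof.
move=> L0 [cB cmax]; split=> // a aB.
by rewrite ler_pM2r ?invr_gt0 // lerXn2r ?nnegrE ?sqrtr_ge0 // cmax.
Qed.

Theorem theorem3 (R : realType) (n : nat) (f : 'cV[R]_n -> R) (fstar : R)
  (B : {set {set 'I_n}}) (H : forall b : {set 'I_n}, 'M[R]_#|b|)
  (x : nat -> 'cV[R]_n) (b : nat -> {set 'I_n})
  (hf : forall y : 'cV[R]_n, differentiable f y)
  (hfstar : forall y : 'cV[R]_n, fstar <= f y)
  (hB : block_family B)
  (hH : forall c : {set 'I_n}, c \in B -> posdef (H c))
  (hLip : blk_lipschitz B H f)
  (hstep : forall k : nat, x k.+1 = bcd_step H f (b k) (x k))
  (hrule :
    [\/ forall k : nat, GSQ B H (grad f (x k)) (b k),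
        exists D : {set 'I_n} -> 'I_n -> R,
          [/\ forall (c : {set 'I_n}) (i : 'I_n),
                c \in B -> i \in c -> 0 < D c i,
              forall c : {set 'I_n}, c \in B -> H c = diag_blk D c &
              forall k : nat, GSD B D (grad f (x k)) (b k)],
        exists L : {set 'I_n} -> R,
          [/\ forall c : {set 'I_n}, c \in B -> 0 < L c,
              forall c : {set 'I_n}, c \in B -> H c = (L c)%:M &
              forall k : nat, GSL B L (grad f (x k)) (b k)] |
        exists L : R,
          [/\ 0 < L,
              forall c : {set 'I_n}, c \in B -> H c = L%:M &
              forall k : nat, GS B (grad f (x k)) (b k)]])
  (k : nat) (hk : (1 <= k)%N) :
  \big[Num.min/blknorm B H (grad f (x 0%N)) ^+ 2]_(t < k)
      blknorm B H (grad f (x t)) ^+ 2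
    <= 2 * (f (x 0%N) - fstar) / k%:R.
Proof.
(* All four rules reduce to [GSQ]; the rest of the argument uses only this. *)
have bQ t : GSQ B H (grad f (x t)) (b t).
  case: hrule => [//|[D [D0 HD bD]]|[L [_ HL bL]]|[L [L0 HL bL]]].
  - exact: GSD_GSQ (bD t).
  - exact: GSL_GSQ (bL t).
  - by apply: (GSL_GSQ _ _ _ _ (fun=> L)) => //; exact: GS_GSL (bL t).
have decr t : blknorm B H (grad f (x t)) ^+ 2 <= 2 * (f (x t) - f (x t.+1)).
  have bB := (bQ t).1; rewrite (blknorm_argmax (bQ t)) hstep.
  have := block_descent _ _ f B H (b t) (x t) hf hLip bB (hH _ bB); lra.
(* The seed of this minimum is its term at [t = 0], present since [1 <= k], so [m] is the true
   minimum. *)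
set m := \big[_/_]_(_ < _) _.
(* Write [m * k%:R] as a sum of [k] copies of [m], to be compared term by term with the
   decreases. *)
rewrite ler_pdivlMr ?ltr0n // mulr_natr -[k in m *+ k]card_ord -sumr_const.
apply: (@le_trans _ _ (\sum_(t < k) 2 * (f (x t) - f (x t.+1)))).
  apply: ler_sum => t _; apply: le_trans (decr t).
  exact: (bigmin_le _ _ (fun s : 'I_k => blknorm B H (grad f (x s)) ^+ 2)).
rewrite -mulr_sumr ler_pM2l // -(big_mkord xpredT (fun t => f (x t) - f (x t.+1))).
(* Telescoping is applied to [- f (x t)], since each summand is an earlier value minus a later one;
   what remains is [fstar <= f (x k)]. *)
rewrite (telescope_sumr_eq (fun t => - f (x t))) // => [|t _]; last first.
  by rewrite opprK addrC.
by rewrite opprK addrC lerD2l lerN2.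
Qed.
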